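(* For every rooted tree $\tau$, $$\prod_{v\in\tau} b(v)\;\le\;\prod_{v\in\tau} d(v).$$ Moreover, equality holds if and only if $\tau$ is a path with an endpoint at the root $R$.
   Context: A rooted tree $\tau$ is a finite tree with a distinguished vertex $R$, the root. For a vertex $v$, $b(v)$ is the size of the branch below $v$, i.e. the number of vertices $w$ (including $v$ itself) such that $v$ lies on the path from $w$ to $R$. $d(v)$ is the number of vertices on the shortest path from $v$ to $R$ (including both endpoints; so $d(R)=1$). *)

(* Defs.v *)
From mathcomp Require Import all_boot.

Set Implicit Arguments.
Unset Strict Implicit.
Unset Printing Implicit Defensive.

(* A cycle of a simple graph has at least three vertices: the duplicate-free
   [cycle]s of size 2 are single edges traversed back and forth. *)
Record rooted_tree (V : finType) := RootedTree {
  edge : rel V;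
  root : V;
  edge_sym : symmetric edge;
  edge_irr : irreflexive edge;
  edge_connected : forall x y : V, connect edge x y;
  edge_acyclic : forall c : seq V, ucycle edge c -> size c <= 2
}.

Section RootedTree.
Variables (V : finType) (t : rooted_tree V).
Implicit Types v w : V.

(* As in [path], a path from x is represented by its vertices after x;
   paths do not repeat vertices. *)
Definition path_to_root w (p : seq V) : bool :=
  [&& path (edge t) w p, last w p == root t & uniq (w :: p)].

Lemma exists_path w : exists p, path_to_root w p.
Proof.
have /connectP[p pth lst] := edge_connected t w (root t).
move: lst; case/shortenP: pth => q qpth quniq _ lst.
by exists q; rewrite /path_to_root qpth -lst eqxx.
Qed.

(* The list of all vertices of the path from w to the root, both endpoints
   included; the chosen path is unique since t is a tree. *)
Definition tree_path w : seq V := w :: xchoose (exists_path w).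

Definition b v : nat := #|[set w | v \in tree_path w]|.

Lemma exists_path_length v :
  exists n, [exists p : n.-tuple V, path_to_root v p].
Proof.
have [p pP] := exists_path v.
by exists (size p); apply/existsP; exists (in_tuple p).
Qed.

(* [ex_minn] is the least number of edges, hence one less than the least
   number of vertices, of a path from v to the root. *)
Definition d v : nat := (ex_minn (exists_path_length v)).+1.

(* The sequence root :: s lists the vertices in the order of the path. *)
Definition is_path_from_root : Prop :=
  exists s : seq V,
    [/\ uniq (root t :: s),
        forall x, x \in root t :: s
      & forall x y, edge t x y =
          (index y (root t :: s) == (index x (root t :: s)).+1)
          || (index x (root t :: s) == (index y (root t :: s)).+1)].

End RootedTree.

(* Main.v *)
Require Import Defs.
From mathcomp Require Import all_boot zify.

(** For [u] on the path from [v] to the root let [e u v] be the distance from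
    [u] to [v].  The distances [e u v] over the branch [B] below [u] form an
    initial segment of the naturals, which forces
    [#|B| * \prod_(v in B, v != u) e u v <= \prod_(v in B) (e u v + 1)], with
    equality iff some [v] of [B] is at distance [#|B| - 1] from [u].
    Multiplying over all [u] and exchanging the products, the path from [v] to
    the root contributes [(d v - 1)!] on the left and [(d v)!] on the right, so
    that what remains is the inequality between the products of [b] and [d]. *)

Set Implicit Arguments.
Unset Strict Implicit.
Unset Printing Implicit Defensive.

(** * Products over down-closed sets *)

Section DownClosed.
Variables (T : finType) (e : T -> nat).

(** Asking only for a predecessor of each positive value keeps the condition stable under removing
    an element where [e] is maximal. *)
Definition down_closed (B : {set T}) : Prop :=
  forall v, v \in B -> 0 < e v -> exists2 w, w \in B & e v = (e w).+1.

(** Descending from [v] by predecessors meets each of the [e v + 1] values from 0 to [e v]. *)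
Lemma down_closed_lt_card (B : {set T}) v :
  down_closed B -> v \in B -> e v < #|B|.
Proof.
move=> cB vB; rewrite cardE -(size_map e) -(size_iota 0 (e v).+1).
apply: uniq_leq_size; first exact: iota_uniq.
move=> k; rewrite mem_iota add0n ltnS /=.
move: (erefl (e v)); move: {2 3}(e v) => n.
elim: n v vB => [|n IHn] v vB ev.
  by rewrite leqn0 => /eqP->; rewrite -ev map_f // mem_enum.
rewrite leq_eqVlt => /orP[/eqP->|]; first by rewrite -ev map_f // mem_enum.
have [|w wB] := cB v vB; first by rewrite ev.
by rewrite ev => -[/esym ew]; apply: IHn ew.
Qed.

(** In the equality case [e] takes each value below [#|B|] exactly once, and both sides are the
    factorial of [#|B|]. *)
Lemma leqif_card_prod_down_closed u (B : {set T}) :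
    u \in B -> e u = 0 -> {in B, forall v, v != u -> 0 < e v} ->
    down_closed B ->
  #|B| * \prod_(v in B | v != u) e v <= \prod_(v in B) (e v).+1
    ?= iff [exists v in B, #|B| <= (e v).+1].
Proof.
move=> + eu; have [m] := ubnP #|B|; elim: m B => // m IHm B ltBm uB posB cB.
have [v0 /andP[v0B v0u]|B1] := pickP [pred v in B | v != u]; last first.
  have defB : B = [set u].
    apply/setP=> v; rewrite inE; have /= := B1 v.
    by have [->|] := eqVneq v u; rewrite ?andbT // uB.
  rewrite big1 => [|v /andP[vB vu]]; last by have := B1 v; rewrite /= vB vu.
  rewrite defB big_set1 cards1 eu; split=> //; apply/esym/existsP; exists u.
  by rewrite set11 eu.
(* Removing an element [v] where [e] is maximal leaves a down-closed set, and
   [#|B| * e v <= (#|B| - 1) * (e v + 1)] because [e v < #|B|]. *)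
pose v := [arg max_(v > v0 | (v \in B) && (v != u)) e v].
have : [/\ v \in B, v != u & {in B, forall w, e w <= e v}].
  rewrite /v; case: arg_maxnP => [|w /andP[wB wu] wmax]; first exact/andP.
  split=> // x xB; have [->|xu] := eqVneq x u; first by rewrite eu.
  by apply: wmax; rewrite xB xu.
move: v => v [vB vu vmax]; have ev := posB v vB vu.
have cardB : #|B| = #|B :\ v|.+1 by rewrite (cardsD1 v) vB.
have cB' : down_closed (B :\ v).
  move=> w /setD1P[wv wB] ew; have [x xB ex] := cB w wB ew.
  exists x => //; rewrite !inE xB andbT; apply: contraTneq (vmax w wB) => <-.
  by rewrite ex ltnn.
have leev : e v <= #|B :\ v|.
  by have := down_closed_lt_card cB vB; rewrite cardB.
have [||||leB' eqB'] := IHm (B :\ v).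
- by rewrite -cardB in ltBm *; lia.
- by rewrite !inE eq_sym vu.
- by move=> w /setD1P[_]; apply: posB.
- exact: cB'.
have -> : [exists w in B, #|B| <= (e w).+1] = (#|B :\ v| <= e v).
  apply/existsP/idP => [[w /andP[wB]]|le]; last by exists v; rewrite vB cardB.
  by rewrite cardB ltnS => /leq_trans; apply; apply: vmax.
rewrite (bigD1 v) ?vB //= [X in _ <= X ?= iff _](bigD1 v) //=.
set P := \prod_(_ in _ :\ _ | _) _ in leB' eqB'.
set Q := \prod_(_ in _ :\ _) _ in leB' eqB'.
have -> : \prod_(i | (i \in B) && (i != u) && (i != v)) e i = P.
  by apply: eq_bigl => i; rewrite !inE andbAC [_ && (_ \in _)]andbC.
have -> : \prod_(i in B | i != v) (e i).+1 = Q.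
  by apply: eq_bigl => i; rewrite !inE andbC.
have P0 : 0 < P.
  by apply: prodn_cond_gt0 => i /andP[/setD1P[_]]; apply: posB.
(* For [e v < #|B :\ v|] already [#|B| * e v < #|B :\ v| * (e v + 1)], and positivity of [P] keeps
   this strict. *)
rewrite cardB; case: leqP => [ge|lt]; last first.
  apply/leqifP/(@leq_trans ((e v).+1 * (#|B :\ v| * P))); last first.
    by rewrite leq_mul2l leB' orbT.
  by rewrite !mulnA ltn_pmul2r // mulSn mulnC mulSn addnC; lia.
have eqev : e v = #|B :\ v| by apply/eqP; rewrite eqn_leq leev.
(* The predecessor of [v] has value [#|B :\ v| - 1], which is the equality case of the induction
   hypothesis. *)
have /eqP <- : #|B :\ v| * P == Q.
  rewrite eqB'; have [w wB evw] := cB v vB ev; apply/existsP; exists w.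
  rewrite !inE wB andbT -evw ge andbT; apply: contraPneq evw => ->; lia.
by rewrite eqev; apply/leqifP.
Qed.

End DownClosed.

(** Positivity of the right-hand product is carried along, because [leqif_mul] also admits equality
    when that product is 0. *)
Lemma leqif_prod (I : finType) (E F : I -> nat) (C : pred I) :
    (forall i, 0 < F i) -> (forall i, E i <= F i ?= iff C i) ->
  \prod_i E i <= \prod_i F i ?= iff [forall i, C i].
Proof.
move=> F0 EF; have -> : [forall i, C i] = \big[andb/true]_i C i.
  by rewrite big_andE; apply: eq_forallb.
suff [] : 0 < \prod_i F i /\
    \prod_i E i <= \prod_i F i ?= iff \big[andb/true]_i C i by [].
elim/big_rec3: _ => [|i c q p _ [q0 IH]]; first by split.
split; first by rewrite muln_gt0 F0.
have := leqif_mul (EF i) IH.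
by rewrite muln_eq0 !eqn0Ngt F0 q0.
Qed.

(** * Paths to the root *)

Section Tree.
Variables (V : finType) (t : rooted_tree V).
Implicit Types (u v w x y : V) (p q : seq V).

Local Notation E := (edge t).
Local Notation R := (Defs.root t).
Local Notation tp := (tree_path t).

(** Two paths that separate at [w] and both end at the root would close up to a cycle through
    [w]. *)
Lemma path_to_root_uniq w p q :
  path_to_root t w p -> path_to_root t w q -> p = q.
Proof.
elim: p w q => [|x p IHp] w [|y q] //=.
- move=> /and3P[_ /= /eqP wR _] /and3P[_ /= /eqP lst /andP[+ _]].
  by rewrite wR -lst mem_last.
- move=> /and3P[_ /= /eqP lst /andP[+ _]] /and3P[_ /= /eqP wR _].
  by rewrite wR -lst mem_last.
move=> /and3P[/= /andP[wx px] lx /andP[wxp ux]].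
move=> /and3P[/= /andP[wy py] ly /andP[wyq uy]].
have [eqxy|neqxy] := eqVneq x y.
  rewrite -eqxy in py ly uy *; congr cons; apply: (IHp x).
    by rewrite /path_to_root px lx.
  by rewrite /path_to_root py ly.
(* Joining the two tails at the root connects [x] and [y] away from [w]. *)
pose e' := [rel a c | [&& E a c, a != w & c != w]].
have e'path z r : w \notin z :: r -> path E z r -> path e' z r.
  elim: r z => //= c r IHr z; rewrite inE negb_or eq_sym => /andP[zw wr].
  case/andP=> -> /IHr->//; move: wr; rewrite inE negb_or eq_sym.
  by case/andP=> -> _; rewrite zw.
have e'conn z r : w \notin z :: r -> path E z r -> last z r == R ->
    connect e' z R.
  by move=> wr pr /eqP lr; apply/connectP; exists r; rewrite ?e'path.
have e'sym : connect_sym e'.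
  apply: sym_connect_sym => a c /=.
  by rewrite edge_sym [(a != w) && _]andbC.
have : connect e' x y.
  apply: connect_trans (e'conn x p wxp px lx) _.
  by rewrite e'sym; apply: e'conn ly.
case/connectP=> r0; case/shortenP=> r pr ur _ lr.
have wr : w \notin x :: r.
  rewrite inE negb_or; apply/andP; split.
    by move: wxp; rewrite inE negb_or => /andP[].
  elim: (r) (x) pr => //= c s IHs z /andP[/and3P[_ _ cw] /IHs].
  by rewrite inE negb_or eq_sym cw.
have /edge_acyclic : ucycle E (w :: x :: r).
  rewrite /ucycle /= rcons_path -lr wx edge_sym wy andbT /=.
  rewrite wr; move: ur => /= ->; rewrite andbT.
  by apply: sub_path pr => a c /= /and3P[].
(* Acyclicity bounds the length by 2, so [r] is empty and [y = x]. *)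
by case: (r) lr => //= yx; rewrite yx eqxx in neqxy.
Qed.

Lemma tree_pathP w : path_to_root t w (behead (tp w)).
Proof. exact: (xchooseP (exists_path t w)). Qed.

Lemma tree_path_uniq w : uniq (tp w).
Proof. by have /and3P[] := tree_pathP w. Qed.

(** By uniqueness the choice made in [tree_path] is immaterial. *)
Lemma tree_path_eq w p : path_to_root t w p -> tp w = w :: p.
Proof. by move=> /(path_to_root_uniq (tree_pathP w)) <-. Qed.

Lemma tree_path_root : tp R = [:: R].
Proof. by apply: tree_path_eq; rewrite /path_to_root /= eqxx. Qed.

Lemma root_in_tree_path w : R \in tp w.
Proof. by have /and3P[_ /eqP <- _] := tree_pathP w; apply: mem_last. Qed.

Lemma index_root_tree_path w : index R (tp w) = (size (tp w)).-1.
Proof.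
have /and3P[_ /eqP <- _] := tree_pathP w.
by rewrite -[last w _]/(last w (tp w)) -nth_last index_uniq ?tree_path_uniq.
Qed.

(** Uniqueness leaves a single length to minimise over. *)
Lemma d_size_tree_path w : d t w = size (tp w).
Proof.
rewrite /d; case: ex_minnP => n /existsP[p /tree_path_eq->] _.
by rewrite /= size_tuple.
Qed.

Lemma tree_path_parent w :
  w != R -> exists2 x, E w x & tp w = w :: tp x.
Proof.
move=> wR; case: (behead (tp w)) (tree_pathP w) => [|x p] pP.
  by case/and3P: pP => _ /= wr; rewrite wr in wR.
rewrite (tree_path_eq pP); case/and3P: pP => /= /andP[wx px] lx /andP[_ ux].
by exists x; rewrite // (@tree_path_eq x p) // /path_to_root px lx.
Qed.

Lemma tree_path_suffix v w : v \in tp w -> suffix (tp v) (tp w).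
Proof.
have [n] := ubnP (size (tp w)); elim: n w => // n IHn w ltn vw.
have [->|vw'] := eqVneq v w; first exact: suffix_refl.
have [wR|wR] := eqVneq w R.
  by move: vw; rewrite wR tree_path_root inE -wR (negPf vw').
have [x _ eqw] := tree_path_parent wR.
rewrite eqw in ltn vw *; apply/suffix_trans/suffix_cons/IHn => //.
by move: vw; rewrite inE (negPf vw').
Qed.

(** Either one endpoint extends the path of the other, or each path is a suffix of the other; the
    latter gives [x = y], against irreflexivity. *)
Lemma edge_tree_path x y :
  E x y -> tp x = x :: tp y \/ tp y = y :: tp x.
Proof.
have cons_tp z w : E z w -> z \notin tp w -> tp z = z :: tp w.
  move=> zw zNw; apply: tree_path_eq; have /and3P[pw lw uw] := tree_pathP w.
  by apply/and3P; split; rewrite /= ?zw // zNw.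
move=> xy; have [xiny|] := boolP (x \in tp y); last by left; apply: cons_tp.
right; apply: cons_tp; first by rewrite edge_sym.
apply/negP => yinx.
have /suffixP[s1 e1] := tree_path_suffix xiny.
have /suffixP[s2 e2] := tree_path_suffix yinx.
move: e1; rewrite e2 catA => /(congr1 size); rewrite !size_cat => /eqP.
rewrite -[X in X == _]add0n eqn_add2r eq_sym addn_eq0 => /andP[_].
move=> /nilP s20; move: e2; rewrite s20 => -[exy _].
by move: xy; rewrite exy edge_irr.
Qed.

(** * Branches and the product inequality *)

Lemma prod_index_succ v :
  \prod_(u in tp v) (index u (tp v)).+1 = (size (tp v))`!.
Proof.
rewrite -big_uniq ?tree_path_uniq // (big_nth v) fact_prod big_add1.
by apply: eq_big_nat => i /andP[_ lti]; rewrite index_uniq ?tree_path_uniq.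
Qed.

Lemma prod_index v :
  \prod_(u in tp v | u != v) index u (tp v) = (size (tp v)).-1`!.
Proof.
have := tree_path_uniq v; rewrite /tree_path; move: (xchoose _) => p /=.
case/andP=> vNp up.
rewrite (eq_bigl (mem p)) => [|u]; last first.
  by rewrite !inE; have [->|] := eqVneq u v; rewrite ?(negPf vNp) ?andbT.
rewrite -big_uniq //= (big_nth v) fact_prod big_add1.
apply: eq_big_nat => i /andP[_ lti]; rewrite index_uniq //.
by case: eqVneq => // e; move: vNp; rewrite {1}e mem_nth.
Qed.

(** The cardinal of this set is [b t u] by conversion; for [v] in it, [index u (tp v)] is the
    distance from [u] to [v]. *)
Definition branch u : {set V} := [set v | u \in tp v].

(** The parent of a vertex [v != u] of the branch is again in the branch, one step closer to [u]. *)
Lemma branch_down_closed u :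
  down_closed (fun v => index u (tp v)) (branch u).
Proof.
move=> v; rewrite inE => uv; have [<-|vu] := eqVneq v u.
  by rewrite /= eqxx.
have [vR|vR] := eqVneq v R.
  by move: uv; rewrite vR tree_path_root inE -vR eq_sym (negPf vu).
have [x _ eqv] := tree_path_parent vR; move=> _; exists x.
  by move: uv; rewrite eqv !inE eq_sym (negPf vu).
by rewrite eqv /= (negPf vu).
Qed.

Lemma index_tree_path_gt0 u v : v != u -> 0 < index u (tp v).
Proof. by rewrite /= => /negPf->. Qed.

Lemma leqif_prod_b_d :
  \prod_v b t v <= \prod_v d t v
    ?= iff [forall u, exists v in branch u, b t u <= (index u (tp v)).+1].
Proof.
have key u : b t u * \prod_(v in branch u | v != u) index u (tp v)
    <= \prod_(v in branch u) (index u (tp v)).+1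
    ?= iff [exists v in branch u, b t u <= (index u (tp v)).+1].
  apply: leqif_card_prod_down_closed (@branch_down_closed u).
  - by rewrite inE mem_head.
  - by rewrite /= eqxx.
  - by move=> v _; apply: index_tree_path_gt0.
have [|le eqC] := leqif_prod _ key; first by move=> u; apply: prodn_gt0.
have leftE : \prod_u (b t u * \prod_(v in branch u | v != u) index u (tp v))
    = (\prod_u b t u) * \prod_v (d t v).-1`!.
  rewrite big_split; congr (_ * _); rewrite (exchange_big_dep predT) //.
  apply: eq_bigr => v _; rewrite d_size_tree_path -prod_index.
  by apply: eq_bigl => u; rewrite inE eq_sym.
have rightE : \prod_u \prod_(v in branch u) (index u (tp v)).+1
    = (\prod_v d t v) * \prod_v (d t v).-1`!.
  rewrite -big_split (exchange_big_dep predT) //.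
  (* [d t v] is a successor by definition, so its factorial unfolds by computation. *)
  apply: eq_bigr => v _; transitivity (d t v)`!; last by [].
  rewrite d_size_tree_path -prod_index_succ.
  by apply: eq_bigl => u; rewrite inE.
have fact_pos : 0 < \prod_v (d t v).-1`!.
  by apply: prodn_gt0 => v; apply: fact_gt0.
rewrite leftE rightE leq_pmul2r // in le.
by split=> //; rewrite -eqC leftE rightE eqn_pmul2r.
Qed.

(** * The equality case *)

(** The vertex [v] is the far end of the path, and [R :: s] is its tree path reversed. *)
Lemma path_iff_covering :
  is_path_from_root t <-> exists v, forall x, x \in tp v.
Proof.
split=> [[s [us alls edges]]|[v allv]].
  pose P := R :: s.
  exists (last R s) => x; rewrite (@tree_path_eq _ (rev (belast R s))).
    by rewrite -rev_rcons -lastI mem_rev alls.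
  apply/and3P; split.
  - rewrite rev_path; apply/(pathP R) => i lti /=.
    have := edges (nth R P i.+1) (nth R P i).
    by rewrite !index_uniq ?eqxx ?orbT //= ltnS ltnW.
  - by case: (s) => //= y r; rewrite rev_cons last_rcons.
  - by rewrite -rev_rcons -lastI rev_uniq.
have defv : R :: behead (rev (tp v)) = rev (tp v).
  have /and3P[_ /eqP lv _] := tree_pathP v.
  suff -> : rev (tp v) = R :: rev (belast v (behead (tp v))) by [].
  by rewrite -lv -rev_rcons -lastI.
(* Since [tp x] is a suffix of [tp v], its size fixes the position of [x] counted from the root. *)
have idx x : (index x (rev (tp v))).+1 = size (tp x).
  have /suffixP[s es] := tree_path_suffix (allv x).
  rewrite es rev_cat index_cat mem_rev mem_head.
  rewrite -[tp x]/(x :: behead (tp x)) rev_cons -cats1 index_cat mem_rev.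
  have /= /andP[/negPf-> _] := tree_path_uniq x.
  by rewrite /= eqxx addn0 size_rev.
exists (behead (rev (tp v))); rewrite defv; split.
- by rewrite rev_uniq tree_path_uniq.
- by move=> x; rewrite mem_rev.
(* The parent of [y] has the same position as [x], hence is [x]. *)
have cons_edge x y : size (tp y) = (size (tp x)).+1 -> E y x.
  move=> sz; have [yR|/tree_path_parent[z yz ey]] := eqVneq y R.
    by move: sz; rewrite yR tree_path_root.
  suff -> : x = z by [].
  apply: (@index_inj _ v (rev (tp v))); rewrite ?mem_rev //.
  by apply: succn_inj; rewrite !idx; apply: succn_inj; rewrite -sz ey.
move=> x y; rewrite -[index y _ == _]eqSS -[index x _ == _]eqSS !idx.
apply/idP/idP.
  by case/edge_tree_path=> ->; rewrite /= eqxx ?orbT.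
by case/orP=> /eqP/cons_edge //; rewrite edge_sym.
Qed.

(** If [tp v] covers the tree, the branch below [u] lies in the part of [tp v] from [v] to [u].
    Conversely, the branch below the root is the whole tree, so the condition at [R] makes [tp v] as
    long as [#|V|]. *)
Lemma covering_iff_branches :
  (exists v, forall x, x \in tp v) <->
  [forall u, exists v in branch u, b t u <= (index u (tp v)).+1].
Proof.
split=> [[v allv]|/forallP/(_ R)/existsP[v /andP[_ le]]].
  apply/forallP => u; apply/existsP; exists v; rewrite inE allv /=.
  have ltu : index u (tp v) < size (tp v) by rewrite index_mem.
  rewrite -[X in _ <= X](size_takel ltu).
  apply: leq_trans (card_size _); apply: subset_leq_card.
  apply/subsetP=> x; rewrite inE => ux.
  have /suffixP[s es] := tree_path_suffix (allv x).
  have uNs : u \notin s.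
    have := tree_path_uniq v; rewrite es cat_uniq => /and3P[_ /hasPn + _].
    by apply.
  rewrite es index_cat (negPf uNs) -addnS take_cat ltnNge leq_addr /= addKn.
  by rewrite mem_cat /= inE eqxx orbT.
exists v; have bR : b t R = #|V|.
  by apply: eq_card => x; rewrite inE root_in_tree_path.
move: le; rewrite bR index_root_tree_path prednK // => le.
have /card_uniqP cardv := tree_path_uniq v.
have /subset_cardP/(_ (subset_predT _)) inv : #|tp v| = #|V|.
  by apply/eqP; rewrite eqn_leq max_card cardv.
by move=> x; rewrite inv.
Qed.

End Tree.

Theorem theorem2p1 (V : finType) (t : rooted_tree V) :
  \prod_(v : V) b t v <= \prod_(v : V) d t v /\
  (\prod_(v : V) b t v = \prod_(v : V) d t v <-> is_path_from_root t).
Proof.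
have [le eqbd] := leqif_prod_b_d t; split=> //.
by rewrite path_iff_covering covering_iff_branches -eqbd; split=> /eqP.
Qed.
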